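(* Let $n,r$ be integers with $1\le r<n/2$, let $\delta$ be a real number with $\delta<10^{-3}n^{-4}$, and let $G$ be an intersecting $r$-graph on $n$ vertices with $|G|>(1-\delta)\binom{n-1}{r-1}$. Then there is a vertex $v$ of $G$ such that all but at most $25n\delta^{1/2}\binom{n-1}{r-1}$ edges of $G$ contain $v$.
   Context: An $r$-graph $G$ consists of a finite vertex set $V(G)$ and a set $E(G)$ of edges, each edge being an $r$-element subset of $V(G)$; $|G|=|E(G)|$. An $r$-graph is intersecting if every two of its edges have at least one common vertex. *)

(* Defs.v *)
From HB Require Import structures.
From mathcomp Require Import all_boot all_order all_algebra.
From mathcomp Require Import reals.

Set Implicit Arguments.
Unset Strict Implicit.
Unset Printing Implicit Defensive.

Record r_graph (r : nat) := R_Graph {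
  vertex : finType;
  edges : {set {set vertex}};
  edges_card : forall e : {set vertex}, e \in edges -> #|e| = r
}.

(* Only distinct edges are compared; for 1 <= r a single edge always meets
   itself, so dropping [e != f] would not change the notion. *)
Definition intersecting (r : nat) (G : r_graph r) : Prop :=
  forall e f : {set vertex G},
    e \in edges G -> f \in edges G -> e != f -> e :&: f != set0.

(* Main.v *)
Require Import Defs.
From HB Require Import structures.
From mathcomp Require Import all_boot all_order all_algebra all_fingroup.
From mathcomp Require Import reals zify lra.

(** Katona's circle method.  Place the vertices around a circle by a uniformly
    random permutation: an intersecting family contains at most r of the n arcs
    of length r, and when it contains exactly r they are the arcs through a
    common vertex.  Since |G| is close to the bound, few placements are
    deficient.  Call a placement centred if the arcs in G are those through the
    vertex v placed at position 0.  An adjacent transposition away from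
    position 0 keeps v in place and keeps a placement centred unless it becomes
    deficient; such transpositions sort any permutation fixing position 0 in at
    most 2 n^2 steps, and deficient placements, being invariant under rotation,
    are equally many for each v at position 0.  Hence for every v either few or
    almost all of the placements of v at position 0 are centred.  As almost every placement has a
    centred rotation, the second case occurs for some v, and then almost every
    r-set containing v is an edge. *)

Set Implicit Arguments.
Unset Strict Implicit.
Unset Printing Implicit Defensive.

Import Order.TTheory GRing.Theory Num.Theory.

(** * Periodic 0-1 patterns on a cycle *)

Section CyclicPattern.
Variables (n r : nat) (a : nat -> bool).
Hypotheses (r_gt0 : 0 < r) (r_half : 2 * r < n).
Hypothesis a_per : forall i, a (i + n) = a i.
(** Here [a i] stands for the arc of [r] points starting at [i] being in the family. The two
    inequalities express that the arcs starting at [i] and [j] are disjoint on a circle of length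
    [n]. *)
Hypothesis a_int : forall i j, a i -> a j -> i + r <= j -> j + r <= i + n -> False.

Lemma periodic_modn i : a (i %% n) = a i.
Proof.
rewrite [in RHS](divn_eq i n); elim: (i %/ n) => [|q IHq]; first by rewrite mul0n.
by rewrite mulSnr addnAC a_per.
Qed.

Lemma periodic_sum p : \sum_(i < n) a (p + i) = \sum_(i < n) a i.
Proof.
elim: p => [|p <-]; first by apply: eq_bigr.
have: \sum_(i < n.+1) a (p + i) = \sum_(i < n.+1) a (p + i) by [].
rewrite {1}big_ord_recl big_ord_recr /= addn0 a_per [RHS]addnC => /addnI <-.
by apply: eq_bigr => i _; rewrite addSnnS.
Qed.

(** An arc starting between [r] and [n - r] is disjoint from arc 0, so it is excluded. The other
    starts pair up as [k] and [k + (n - r)]: the second arc of a pair ends just where the first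
    begins. *)
Lemma pair_sum : a 0 ->
  \sum_(i < n) a i = 1 + \sum_(1 <= k < r) (a k + a (k + (n - r))).
Proof.
move=> a0; rewrite -(big_mkord xpredT (fun i => nat_of_bool (a i))).
rewrite (big_cat_nat (n := r)) //=; [|lia].
rewrite (big_cat_nat (m := r) (n := 1 + (n - r))) //=; [|lia|lia].
rewrite [X in _ + (X + _)]big_nat_cond.
rewrite [X in _ + (X + _)]big1 => [|i /andP[/andP[ri ir] _]].
  rewrite big_ltn // a0 add0n -addnA big_addn.
  by rewrite (_ : n - (n - r) = r) ?big_split //; lia.
by case ai: (a i) => //; case: (a_int a0 ai); lia.
Qed.

Lemma pair_le1 k : 0 < k < r -> a k + a (k + (n - r)) <= 1.
Proof.
move=> kr; case ak: (a k) => //=; last by case: (a _).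
by case ak': (a _) => //; case: (a_int ak ak'); lia.
Qed.

End CyclicPattern.

(** * Katona's bound on the circle and its equality case *)

Section Katona.
Variables (n r : nat) (a : nat -> bool).
Hypotheses (r_gt0 : 0 < r) (r_half : 2 * r < n).
Hypothesis a_per : forall i, a (i + n) = a i.
Hypothesis a_int : forall i j, a i -> a j -> i + r <= j -> j + r <= i + n -> False.

Let shift_int p i j : a (p + i) -> a (p + j) -> i + r <= j -> j + r <= i + n -> False.
Proof. by move=> ai aj ij ji; apply: (a_int ai aj); lia. Qed.

Lemma katona_count : \sum_(i < n) a i <= r.
Proof.
have [i ai|a0] := pickP (fun i : 'I_n => a i); last first.
  by rewrite big1 // => i _; rewrite a0.
rewrite -(periodic_sum a_per i).
rewrite (pair_sum (a := fun j => a (i + j)) r_gt0 r_half) //; last 2 first.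
- exact: shift_int.
- by rewrite addn0.
rewrite -[leqRHS](subnKC r_gt0) leq_add2l -[leqRHS]muln1 -sum_nat_const_nat.
rewrite big_nat_cond [leqRHS]big_nat_cond; apply: leq_sum => k /andP[kr _].
exact: (pair_le1 (a := fun j => a (i + j)) r_gt0 r_half (@shift_int i)).
Qed.

Lemma katona_extremal : \sum_(i < n) a i = r ->
  exists p, forall i, i < n -> a (p + i) = (i == 0) || (n - r < i).
Proof.
move=> sum_r.
(* Take [p] at the end of a run. Runs are finite: [r + 1] consecutive starts would include the
   disjoint arcs at [i] and [i + r]. *)
have [p ap ap1] : exists2 p, a p & ~~ a p.+1.
  have [i ai|a0] := pickP (fun i : 'I_n => a i); last first.
    by move: sum_r r_gt0; rewrite big1 => [<-//|i _]; rewrite a0.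
  have [/existsP[j /andP[aj naj]]|] :=
      boolP [exists j : 'I_r, a (i + j) && ~~ a (i + j).+1]; first by exists (i + j).
  rewrite negb_exists => /forallP step.
  have all_a j : j <= r -> a (i + j).
    elim: j => [|j IHj] jr; first by rewrite addn0.
    have := step (Ordinal jr); rewrite /= IHj ?(ltnW jr) //= negbK.
    by rewrite addnS.
  by case: (a_int ai (all_a r (leqnn _))); lia.
(* At most one element of each pair {k, k + (n - r)} occurs, and equality in
   the count forces exactly one; as b 1 fails, k + (n - r) is chosen for k = 1,
   and this excludes k + 1, so the choice propagates to k + 1. *)
exists p; pose b i := a (p + i).
have b0 : b 0 by rewrite /b addn0.
have b1 : ~~ b 1 by rewrite /b addn1.
have b_int := @shift_int p.
have pairs : forall k, 0 < k < r -> b k + b (k + (n - r)) = 1.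
  move=> k0 k0r; apply/eqP; rewrite eqn_leq (pair_le1 r_gt0 r_half b_int) //= leqNgt.
  apply/negP => lt1.
  have: \sum_(i < n) b i < r; last by rewrite (periodic_sum a_per p) sum_r ltnn.
  rewrite (pair_sum r_gt0 r_half b_int b0).
  rewrite -[ltnRHS](subnKC r_gt0) ltn_add2l -[ltnRHS]muln1 -sum_nat_const_nat.
  rewrite (bigD1_seq k0) ?iota_uniq ?mem_index_iota //=.
  rewrite [ltnRHS](bigD1_seq k0) ?iota_uniq ?mem_index_iota //= -addSn leq_add //.
  rewrite big_seq_cond [leqRHS]big_seq_cond; apply: leq_sum => k /andP[].
  by rewrite mem_index_iota => kr _; apply: (pair_le1 r_gt0 r_half b_int).
have down : forall k, k.+1 < r -> ~~ b k.+1 && b (k.+1 + (n - r)).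
  elim=> [|k IHk] kr.
    by move: (pairs 1); rewrite (negbTE b1) kr; case: (b (1 + _)) => // /(_ isT).
  have /andP[_ bk] := IHk (ltnW kr).
  have nb : ~~ b k.+2 by apply/negP => bk2; case: (b_int _ _ bk2 bk); lia.
  by move: (pairs k.+2); rewrite (negbTE nb) kr; case: (b (k.+2 + _)) => // /(_ isT).
case=> [|i] i_n; first by rewrite -/(b 0) b0.
rewrite -/(b i.+1) /=; have [hi|hi] := ltnP (n - r) i.+1.
  have [ir|ir] := ltnP (i.+1 - (n - r)) r; last by move: i_n; lia.
  have eq_k : (i.+1 - (n - r)).-1.+1 = i.+1 - (n - r) by lia.
  have := down (i.+1 - (n - r)).-1; rewrite eq_k subnK; last exact: ltnW.
  by rewrite ir => /(_ isT)/andP[].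
have [kr|kr] := ltnP i.+1 r; first by have /andP[/negbTE] := down i kr.
by apply/negP => bi; case: (b_int _ _ b0 bi); lia.
Qed.
End Katona.

(** * Escape counts of a subset under left translation *)

Section Escape.
Variables (gT : finGroupType) (W : {set gT}).

(** This is the edge boundary of [W] in the direction [p] of a Cayley graph. Being subadditive, it
    is controlled on products by its values on generators. *)
Definition escape (p : gT) := #|[set s in W | (p * s)%g \notin W]|.

Lemma escape1 : escape 1%g = 0.
Proof.
by apply/eqP; rewrite cards_eq0 -subset0; apply/subsetP => s; rewrite !inE mul1g andbN.
Qed.

(** If [s] escapes under [p * q], then either [s] escapes under [q], or [q * s] is still in [W] and
    escapes under [p]. *)
Lemma escapeM p q : escape (p * q)%g <= escape p + escape q.
Proof.
rewrite addnC.
pose E := [set s in W | (p * s)%g \notin W].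
pose E' := [set s in W | (q * s)%g \notin W].
apply: leq_trans (_ : #|E' :|: [set (q^-1 * s)%g | s in E]| <= _).
  apply: subset_leq_card; apply/subsetP => s; rewrite !inE => /andP[sW pqs].
  rewrite sW /=; case: (boolP ((q * s)%g \in W)) => //= qs.
  by apply/imsetP; exists (q * s)%g; rewrite ?mulKg // !inE qs mulgA.
by rewrite (leq_trans (leq_card_setU _ _)) // leq_add2l leq_imset_card.
Qed.

(** Each pair of [s] in [W] and [t] in [C] outside [W] is counted exactly once, by
    [p = t * s^-1]. *)
Lemma sum_escape (H C : {set gT}) :
    W \subset C -> (forall s t, s \in W -> ((t * s^-1)%g \in H) = (t \in C)) ->
  \sum_(p in H) escape p = #|W| * (#|C| - #|W|).
Proof.
move=> WC HC; rewrite -(cardsDS WC).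
under eq_bigr do rewrite /escape -sum1_card.
rewrite (exchange_big_dep (mem W)) /=; last by move=> p s _; rewrite inE => /andP[].
rewrite -sum_nat_const; apply: eq_bigr => s sW.
rewrite -sum1_card (reindex_inj (mulIg s^-1%g)) /=; apply: eq_bigl => t.
by rewrite !inE HC // sW mulgKV andbC.
Qed.
End Escape.

(** * Subadditive functions on permutations, from adjacent swaps upwards *)

Section Sorting.
Variables (T : finType) (f : {perm T} -> nat).
Hypotheses (f1 : f 1%g = 0) (fM : forall s t, f (s * t)%g <= f s + f t).

(** Conjugating by one adjacent swap lengthens the transposition by one place and costs at most
    [2 * b]. *)
Lemma subadditive_tperm (c : nat -> T) (l m b : nat) :
    {in [pred i | l <= i < m] &, injective c} ->
    (forall k, l <= k -> k.+1 < m -> f (tperm (c k) (c k.+1)) <= b) ->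
  forall i d, l <= i -> i + d < m -> f (tperm (c i) (c (i + d))) <= 2 * d * b.
Proof.
move=> c_inj f_adj i d li; elim: d => [|d IHd] idm.
  by rewrite addn0 tperm1 f1.
have adj := f_adj (i + d); rewrite addnS in idm *.
case: d => [|d] in IHd idm adj *.
  by rewrite addn0 in idm adj *; rewrite (leq_trans (adj _ _)) // leq_pmull.
set s := tperm (c (i + d.+1)) (c (i + d.+1).+1) in adj *.
have -> : tperm (c i) (c (i + d.+1).+1) = (s * (tperm (c i) (c (i + d.+1)) * s))%g.
  rewrite -{1}[s]tpermV -conjgE tpermJ tpermL tpermD //.
    by apply/eqP => /c_inj; rewrite !inE; lia.
  by apply/eqP => /c_inj; rewrite !inE; lia.
have := fM s (tperm (c i) (c (i + d.+1)) * s)%g.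
have := fM (tperm (c i) (c (i + d.+1))) s.
have := adj ltac:(lia) idm; have := IHd ltac:(lia).
by lia.
Qed.

(** Multiplying [s] by [tperm x (s x)] makes [x] fixed and moves no new point, so at most [#|D|]
    transpositions are used. *)
Lemma subadditive_perm (D : {set T}) (b : nat) :
    (forall x y, x \in D -> y \in D -> f (tperm x y) <= b) ->
  forall s, perm_on D s -> f s <= #|D| * b.
Proof.
move=> f_tperm s sD.
have le_sD : #|[set x | s x != x]| <= #|D|.
  by apply/subset_leq_card/subsetP => x; rewrite inE; apply: (subsetP sD).
elim: #|D| s le_sD sD => [|k IHk] s le_k sD.
    suff -> : s = 1%g by rewrite f1.
    apply/permP => x; rewrite perm1; apply/eqP.
    move: le_k; rewrite leqn0 cards_eq0 => /eqP/setP/(_ x).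
    by rewrite !inE => /negbFE.
  have [x sx|s1] := pickP (fun x => s x != x); last first.
    rewrite (_ : s = 1%g) ?f1 //; apply/permP => x; rewrite perm1.
    by apply/eqP/negbFE/s1.
  have xD : x \in D := subsetP sD _ sx.
  have sxD : s x \in D by rewrite perm_closed.
  rewrite -[s](mulgK (tperm x (s x))) tpermV mulSnr.
  apply: leq_trans (fM _ _) (leq_add (IHk _ _ _) (f_tperm _ _ xD sxD)).
    rewrite -ltnS (leq_trans _ le_k) // (cardsD1 x [set y | s y != y]) inE sx ltnS.
    apply/subset_leq_card/subsetP => y; rewrite !inE permM.
    case: tpermP => [syx _|/perm_inj->|_ syx ->]; rewrite ?eqxx ?andbT //.
      by rewrite syx [x == y]eq_sym andbb; apply: contraNneq sx => yx; rewrite -{1}yx syx.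
    by apply/eqP => yx; apply: syx; rewrite yx.
  apply: perm_onM => //; apply: subset_trans (tperm_on _ _) _.
  by apply/subsetP => y /set2P[]->.
Qed.
End Sorting.

(** * The image of a fixed set under a random permutation *)

Section UniformFibres.
Variable T : finType.
Implicit Types (A B e : {set T}) (s p : {perm T}).

Lemma imset_permM s p A : (s * p)%g @: A = p @: (s @: A).
Proof. by rewrite -imset_comp; apply: eq_imset => x; rewrite permM. Qed.

Lemma imset_perm1 A : (1%g : {perm T}) @: A = A.
Proof. by rewrite (eq_imset (g := id)) ?imset_id // => x; rewrite perm1. Qed.

Lemma imset_tperm (x y : T) A : (x \in A) = (y \in A) -> tperm x y @: A = A.
Proof.
move=> xyA; apply/eqP; rewrite eqEcard card_imset ?leqnn ?andbT; last exact: perm_inj.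
apply/subsetP => _ /imsetP[z zA ->]; case: tpermP zA => [->|->|//].
  by rewrite xyA.
by rewrite -xyA.
Qed.

(** Swapping a point of [A] outside [B] with one of [B] outside [A] shrinks the difference. Common
    points stay fixed, which later allows relabelling while keeping a vertex in place. *)
Lemma perm_imset_trans A B : #|A| = #|B| ->
  exists p, p @: A = B /\ forall x, x \in A -> x \in B -> p x = x.
Proof.
have [k] := ubnP #|A :\: B|; elim: k A => // k IHk A le_k AB.
have [AsubB|] := boolP (A \subset B).
  exists 1%g; split=> [|x _ _]; last by rewrite perm1.
  by rewrite imset_perm1; apply/eqP; rewrite eqEcard AsubB AB leqnn.
case/subsetPn=> x xA xB.
have [y yB yA] : exists2 y, y \in B & y \notin A.
  apply/subsetPn; apply: contra xB => BsubA.
  by have /eqP -> : B == A by rewrite eqEcard BsubA AB leqnn.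
have [||p [pA pfix]] := IHk (tperm x y @: A).
- have sub : tperm x y @: A :\: B \subset (A :\: B) :\ x.
    apply/subsetP => _ /setDP[/imsetP[z zA ->]].
    case: tpermP => [_|zy|/eqP zx _]; rewrite ?yB //; first by rewrite -zy zA in yA.
    by move=> zB; rewrite !inE zx zB.
  by move: (subset_leq_card sub) le_k; rewrite (cardsD1 x (A :\: B)) !inE xA xB /=; lia.
- by rewrite card_imset //; apply: perm_inj.
exists (tperm x y * p)%g; split=> [|z zA zB]; first by rewrite imset_permM.
have tz : tperm x y z = z.
  by rewrite tpermD //; [apply: contraNneq xB => ->|apply: contraNneq yA => ->].
by rewrite permM tz pfix // -{1}tz imset_f.
Qed.

(** Relabelling by [p] injects the fibre over [e] into the fibre over [e']. Hence all fibres over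
    [X] have equal size, and the image of [A] is uniformly distributed on [X]. *)
Lemma uniform_fibres (S : {set {perm T}}) (X F : {set {set T}}) A :
    F \subset X -> (forall s, s \in S -> s @: A \in X) ->
    (forall e e', e \in X -> e' \in X ->
      exists2 p : {perm T}, p @: e = e' & forall s, s \in S -> (s * p)%g \in S) ->
  #|[set s in S | s @: A \in F]| * #|X| = #|F| * #|S|.
Proof.
move=> FX SX trX; pose k e := #|[set s in S | s @: A == e]|.
have card_k (Y : {set {set T}}) : #|[set s in S | s @: A \in Y]| = \sum_(e in Y) k e.
  rewrite -sum1_card (partition_big (fun s => s @: A) (mem Y)) /=; last first.
    by move=> s; rewrite inE => /andP[].
  apply: eq_bigr => e eY; rewrite /k -sum1_card; apply: eq_bigl => s.
  by rewrite !inE; case: eqP => [->|_]; rewrite ?eY ?andbT ?andbF.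
have le_k e e' : e \in X -> e' \in X -> k e <= k e'.
  move=> eX e'X; have [p pe pS] := trX _ _ eX e'X.
  rewrite /k -[leqLHS](card_imset _ (mulIg p)).
  apply/subset_leq_card/subsetP => _ /imsetP[s + ->].
  by rewrite !inE imset_permM => /andP[/pS -> /eqP ->]; rewrite pe eqxx.
have [X0|[e0 e0X]] := set_0Vmem X.
  by move: FX; rewrite X0 subset0 => /eqP ->; rewrite !cards0 muln0.
have k_const e : e \in X -> k e = k e0.
  by move=> eX; apply/eqP; rewrite eqn_leq !le_k.
have sum_k (Y : {set {set T}}) : Y \subset X -> \sum_(e in Y) k e = #|Y| * k e0.
  move=> YX; rewrite -sum_nat_const; apply: eq_bigr => e eY.
  exact/k_const/(subsetP YX).
have -> : S = [set s in S | s @: A \in X].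
  by apply/setP => s; rewrite inE; case: (boolP (s \in S)) => // /SX ->.
rewrite [in LHS](_ : [set s in _ | _] = [set s in S | s @: A \in F]); last first.
  apply/setP => s; rewrite !inE -andbA; case: (s \in S) => //=.
  by rewrite andb_idl //; apply: (subsetP FX).
by rewrite !card_k !sum_k ?subxx // mulnAC mulnA.
Qed.

Lemma card_perm_imset_in A (F : {set {set T}}) :
    {in F, forall e, #|e| = #|A|} ->
  #|[set s : {perm T} | s @: A \in F]| * 'C(#|T|, #|A|) = #|F| * #|{perm T}|.
Proof.
move=> F_card; rewrite -card_draws -[in RHS]cardsT.
rewrite (_ : [set s | _] = [set s in [set: {perm T}] | s @: A \in F]); last first.
  by apply/setP => s; rewrite !inE.
apply: uniform_fibres => [|s _|e e'].
- by apply/subsetP => e eF; rewrite inE F_card.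
- by rewrite inE card_imset //; apply: perm_inj.
rewrite !inE => /eqP eA /eqP e'A.
have [p [pe _]] := perm_imset_trans (etrans eA (esym e'A)).
by exists p => // s _; rewrite inE.
Qed.

Lemma card_draws_in (v : T) k : 0 < k ->
  #|[set e : {set T} | (v \in e) && (#|e| == k)]| = 'C(#|T|.-1, k.-1).
Proof.
case: k => // k _; have T_gt0 : 0 < #|T| by apply/card_gt0P; exists v.
have := card_draws T k.+1; rewrite -{1}(prednK T_gt0) binS.
rewrite -(cardsID [set e : {set T} | v \in e]).
set a := #|_ :&: _|; set b := #|_ :\: _| => ab.
have b_d : b = 'C(#|T|.-1, k.+1).
  rewrite -(cardsC1 v) -cards_draws; apply: eq_card => e; rewrite !inE; congr andb.
  by rewrite subsetC sub1set inE.
have -> : #|[set e : {set T} | (v \in e) && (#|e| == k.+1)]| = a.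
  by apply: eq_card => e; rewrite !inE andbC.
by move: ab; rewrite b_d addnC => /addnI.
Qed.

(** Both sets to be exchanged contain [v], so the relabelling can be chosen to fix [v] and preserves
    the condition at [x]. *)
Lemma card_perm_imset_in_at A (F : {set {set T}}) (x v : T) :
    x \in A -> {in F, forall e, v \in e /\ #|e| = #|A|} ->
  #|[set s : {perm T} | (s x == v) && (s @: A \in F)]| * 'C(#|T|.-1, #|A|.-1)
    = #|F| * #|[set s : {perm T} | s x == v]|.
Proof.
move=> xA F_card; rewrite -(card_draws_in v); last by apply/card_gt0P; exists x.
rewrite (_ : [set s | _] = [set s in [set s : {perm T} | s x == v] | s @: A \in F]).
  apply: uniform_fibres => [|s|e e'].
  - by apply/subsetP => e /F_card[ve cA]; rewrite inE ve cA eqxx.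
  - rewrite !inE card_imset ?eqxx ?andbT; last exact: perm_inj.
    by move/eqP=> <-; apply: imset_f.
  rewrite !inE => /andP[ve /eqP eA] /andP[ve' /eqP e'A].
  have [p [pe pfix]] := perm_imset_trans (etrans eA (esym e'A)); exists p => // s.
  by rewrite !inE permM => /eqP ->; rewrite pfix.
by apply/setP => s; rewrite !inE.
Qed.
End UniformFibres.

(** * Positions on the circle, rotations and arcs *)

Section Circle.
Variables (T : finType) (n r : nat) (x0 : T).
Hypotheses (cardT : #|T| = n) (r_gt0 : 0 < r) (r_half : 2 * r < n).

(** [T] serves both as the positions and as the vertices, so that placements form the group
    [{perm T}]. Indices are reduced modulo the length, so arcs may wrap round; [x0] is only the
    default of [nth]. *)
Definition circ (i : nat) : T := nth x0 (enum T) (i %% #|T|).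
Local Notation c := circ.

Definition arc (i : nat) : {set T} := [set c (i + j) | j : 'I_r].

Let n_gt0 : 0 < n. Proof. by lia. Qed.

Lemma circ_modn i j : (c i == c j) = (i == j %[mod n]).
Proof. by rewrite /circ cardT nth_uniq ?enum_uniq // -cardE cardT ltn_mod. Qed.

Lemma circ_per i : c (i + n) = c i.
Proof. by apply/eqP; rewrite circ_modn modnDr. Qed.

Lemma circ_inj : {in [pred i | i < n] &, injective c}.
Proof. by move=> i j ltin ltjn /eqP; rewrite circ_modn !modn_small // => /eqP. Qed.

Lemma circP t : exists2 i, i < n & t = c i.
Proof.
have lt_t : index t (enum T) < n by rewrite -cardT cardE index_mem mem_enum.
by exists (index t (enum T)); rewrite // /circ cardT modn_small // nth_index ?mem_enum.
Qed.

Lemma rotate_inj : injective (fun t => c (index t (enum T)).+1).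
Proof.
have cK i : index (c i) (enum T) = i %% n.
  by rewrite /circ cardT index_uniq ?enum_uniq // -cardE cardT ltn_mod.
move=> t u; have [i ltin ->] := circP t; have [j ltjn ->] := circP u.
rewrite /= !cK (modn_small ltin) (modn_small ltjn) => /eqP.
rewrite circ_modn -(addn1 i) -(addn1 j) eqn_modDr -circ_modn.
by move/eqP.
Qed.

Definition rotate : {perm T} := perm rotate_inj.

Lemma rotateX p i : (rotate ^+ p)%g (c i) = c (i + p).
Proof.
elim: p i => [|p IHp] i; first by rewrite expg0 perm1 addn0.
rewrite expgS permM permE addnS -addSn -IHp; congr (_ _); apply/eqP.
rewrite circ_modn -(addn1 i) -(addn1 (index _ _)) eqn_modDr.
rewrite {1}/circ cardT index_uniq ?enum_uniq ?modn_mod //.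
by rewrite -cardE cardT ltn_mod.
Qed.

Lemma arc_per i : arc (i + n) = arc i.
Proof. by apply: eq_imset => j; rewrite addnAC circ_per. Qed.

Lemma rotate_arc p i : (rotate ^+ p)%g @: arc i = arc (i + p).
Proof.
rewrite -imset_comp; apply: eq_imset => j /=.
by rewrite rotateX addnAC.
Qed.

Lemma card_arc i : #|arc i| = r.
Proof.
rewrite card_imset ?card_ord // => j k /eqP; rewrite circ_modn eqn_modDl.
by have := ltn_ord j; have := ltn_ord k => kr jr; rewrite !modn_small ?(inj_eq val_inj);
  [move/eqP|lia..].
Qed.

Lemma mem_arc i p : i < n -> p < n ->
  (c p \in arc i) = (i <= p < i + r) || (p + n < i + r).
Proof.
move=> ltin ltpn; apply/imsetP/idP => [[j _ /eqP]|ip].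
  have jr := ltn_ord j; rewrite circ_modn modn_small // eq_sym.
  have [ijn|nij] := ltnP (i + j) n; first by rewrite modn_small // => /eqP; lia.
  by rewrite -(subnK nij) modnDr modn_small; [move/eqP|]; lia.
have [le_ip|lt_pi] := leqP i p.
  have jr : p - i < r by lia.
  by exists (Ordinal jr); rewrite //= subnKC.
have jr : p + n - i < r by lia.
by exists (Ordinal jr); rewrite //= subnKC ?circ_per //; lia.
Qed.

Lemma arc_disjoint i j : i + r <= j -> j + r <= i + n -> arc i :&: arc j = set0.
Proof.
move=> ij ji; apply/setP => t; rewrite !inE; apply/negP => /andP[].
case/imsetP=> k _ -> /imsetP[l _ /esym/eqP]; rewrite circ_modn.
have := ltn_ord k; have := ltn_ord l => lr kr.
rewrite eqn_mod_dvd; last by lia.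
by move/dvdn_leq; lia.
Qed.

(** * Centred and deficient placements of an intersecting family *)

Section Family.
Variable G : {set {set T}}.
Hypothesis G_card : {in G, forall e : {set T}, #|e| = r}.
Hypothesis G_int : {in G &, forall e f : {set T}, e != f -> e :&: f != set0}.
Implicit Types (s : {perm T}) (v : T).

(* Placements act on positions first: (p * s) x = s (p x), so multiplying s on
   the left by p permutes the positions of the circle and multiplying it on the
   right relabels the vertices. *)
Definition arc_in s i := s @: arc i \in G.
Definition narcs s := \sum_(i < n) arc_in s i.
Definition deficient := [set s | narcs s != r].
Definition centred := [set s | [forall i : 'I_n, arc_in s i == (c 0 \in arc i)]].

Lemma arc_in_per s i : arc_in s (i + n) = arc_in s i.
Proof. by rewrite /arc_in arc_per. Qed.

Lemma arc_in_int s i j :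
  arc_in s i -> arc_in s j -> i + r <= j -> j + r <= i + n -> False.
Proof.
move=> si sj ij ji.
have : s @: arc i :&: s @: arc j = set0.
  by rewrite -imsetI ?arc_disjoint ?imset0 // => x y _ _; apply: perm_inj.
move=> I0; have := G_int si sj; rewrite I0 eqxx => ne.
(* [G_int] compares distinct edges only. Equal images would be disjoint from themselves, hence
   empty, against [0 < r]. *)
have /ne// : s @: arc i != s @: arc j.
apply/eqP => e; move: I0; rewrite -e setIid => /eqP.
by rewrite -cards_eq0 card_imset ?card_arc -?lt0n; [lia|apply: perm_inj].
Qed.

Lemma narcs_le s : narcs s <= r.
Proof. exact: (katona_count r_gt0 r_half (arc_in_per s) (@arc_in_int s)). Qed.

Lemma arc_in_rotate p s i : arc_in (rotate ^+ p * s)%g i = arc_in s (i + p).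
Proof. by rewrite /arc_in imset_permM rotate_arc. Qed.

Lemma mem_arc0 i : i < n -> (c 0 \in arc i) = (i == 0) || (n - r < i).
Proof. by move=> ltin; rewrite mem_arc //; lia. Qed.

Lemma deficientPn s : s \notin deficient ->
  exists2 p, p < n & forall i, i < n -> arc_in s (p + i) = (i == 0) || (n - r < i).
Proof.
rewrite inE negbK => /eqP.
case/(katona_extremal r_gt0 r_half (arc_in_per s) (@arc_in_int s)) => p pP.
exists (p %% n) => [|i /pP <-]; first by rewrite ltn_mod.
rewrite -[LHS](periodic_modn (arc_in_per s)) modnDml.
exact: (periodic_modn (arc_in_per s)).
Qed.

Lemma centredP s :
  reflect (forall i, i < n -> arc_in s i = (i == 0) || (n - r < i)) (s \in centred).
Proof.
rewrite inE; apply: (iffP forallP) => [cs i ltin|cs i].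
  by have /eqP := cs (Ordinal ltin); rewrite mem_arc0.
by rewrite cs ?mem_arc0.
Qed.

Lemma rotate_centred s : s \notin deficient ->
  exists2 p, p < n & (rotate ^+ p * s)%g \in centred.
Proof.
case/deficientPn=> p ltpn pP; exists p => //; apply/centredP => i ltin.
by rewrite arc_in_rotate addnC pP.
Qed.

Lemma swap_centred s k : 0 < k -> k.+1 < n -> s \in centred ->
  (tperm (c k) (c k.+1) * s)%g \notin deficient ->
  (tperm (c k) (c k.+1) * s)%g \in centred.
Proof.
move=> k_gt0 kn /centredP s_c; set t := (_ * s)%g => /deficientPn[p ltpn t_p].
(* Only the arcs starting at k + 1 and at k + 1 - r (modulo n) are affected by
   the swap, too few to move the window of arcs lying in G. *)
have t_s i : i < n -> i != k.+1 -> i + r != k.+1 -> i + r != k.+1 + n ->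
    arc_in t i = (i == 0) || (n - r < i).
  move=> ltin i1 i2 i3; rewrite -s_c // /arc_in imset_permM imset_tperm //.
  by rewrite !mem_arc //; lia.
have t_w i : i < n -> arc_in t i = (p < i + r) && (i <= p) || (p + n < i + r).
  move=> ltin; have [le_pi|lt_ip] := leqP p i.
    by rewrite -(subnKC le_pi) t_p; lia.
  rewrite -arc_in_per -(@subnKC p (i + n)); last by lia.
  by rewrite t_p; lia.
(* Test the starts 0, 1, [n - r] and [n - r + 1]. They are affected by the swap only for [k] equal
   to [r - 1], [r], [n - r - 1] and [n - r] respectively, and for each [k] the unaffected tests
   force [p = 0]. If [r = 1], the last start is out of range, but start 0 is never affected and
   suffices. *)
suff p0 : p = 0 by apply/centredP => i ltin; rewrite t_w // p0; lia.
have := t_s 0 n_gt0; rewrite t_w // => t0.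
have := t_s 1; rewrite t_w; last by lia.
move=> t1; have := t_s (n - r); rewrite t_w; last by lia.
move=> t2; have := t_s (n - r).+1.
by case: (ltnP 1 r) => hr; [rewrite t_w|]; lia.
Qed.

Definition based v : {set {perm T}} := [set s : {perm T} | s (c 0) == v].

(** Count pairs of a position and a placement in [S] with [v] at that position. Each placement has
    one such position, and rotation makes all positions equally frequent. *)
Lemma card_based (S : {set {perm T}}) v :
    (forall s, ((rotate * s)%g \in S) = (s \in S)) ->
  n * #|S :&: based v| = #|S|.
Proof.
move=> rotS.
have rotXS p s : ((rotate ^+ p * s)%g \in S) = (s \in S).
  by elim: p s => [|p IHp] s; rewrite ?mul1g // expgSr -mulgA IHp.
have eq_p (p : 'I_n) : \sum_(s in S) (s (c p) == v) = #|S :&: based v|.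
  have -> : #|S :&: based v| = \sum_(s in S) (s (c 0) == v).
    rewrite -sum1_card big_mkcond [RHS]big_mkcond; apply: eq_bigr => s _.
    by rewrite !inE; case: (s \in S); case: eqP.
  rewrite [RHS](reindex_inj (mulgI (rotate ^+ p)%g)) /=.
  by apply: eq_big => s; rewrite ?rotXS // permM rotateX add0n.
transitivity (\sum_(p < n) \sum_(s in S) (s (c p) == v)).
  by rewrite (eq_bigr _ (fun p _ => eq_p p)) sum_nat_const card_ord.
rewrite exchange_big /= -sum1_card; apply: eq_bigr => s _.
have [i ltin e] := circP (s^-1%g v).
rewrite (bigD1 (Ordinal ltin)) //= -e permKV eqxx big1 // => j ji.
apply/eqP; rewrite eqb0; apply: contra ji => /eqP sj.
by apply/eqP/val_inj/circ_inj; rewrite ?inE //= -e -sj permK.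
Qed.

Lemma deficient_rotate s : ((rotate * s)%g \in deficient) = (s \in deficient).
Proof.
rewrite !inE /narcs; congr (_ != _); rewrite -[RHS](periodic_sum (arc_in_per s) 1).
by apply: eq_bigr => i _; rewrite -[rotate]expg1 arc_in_rotate addnC.
Qed.

Lemma card_deficient_based v : n * #|deficient :&: based v| = #|deficient|.
Proof. by apply: card_based; apply: deficient_rotate. Qed.

Lemma card_based_perm v : n * #|based v| = #|{perm T}|.
Proof.
by rewrite -[based v]setTI card_based ?cardsT // => s; rewrite !inE.
Qed.

Lemma sum_centred_based : \sum_v #|centred :&: based v| = #|centred|.
Proof.
rewrite -[RHS]sum1_card (partition_big (fun s : {perm T} => s (c 0)) xpredT) //=.
by apply: eq_bigr => v _; rewrite -sum1_card; apply: eq_bigl => s; rewrite !inE.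
Qed.

Lemma card_perm_le : #|{perm T}| <= n * #|centred| + #|deficient|.
Proof.
pose D p := [set s | (rotate ^+ p * s)%g \in centred].
have cardD p : #|D p| = #|centred|.
  rewrite -!sum1_card [RHS](reindex_inj (mulgI (rotate ^+ p)%g)).
  by apply: eq_bigl => s; rewrite inE.
have -> : n * #|centred| = \sum_(p < n) #|D p|.
  by under eq_bigr do rewrite cardD; rewrite sum_nat_const card_ord.
have le_cup : #|\bigcup_(p < n) D p| <= \sum_(p < n) #|D p|.
  elim/big_ind2: _ => [|A a B b hA hB|//]; rewrite ?cards0 //.
  by apply: leq_trans (leq_add hA hB); apply: leq_card_setU.
apply: leq_trans (leq_add le_cup (leqnn _)).
apply: leq_trans (leq_card_setU _ _); rewrite -cardsT subset_leq_card //.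
apply/subsetP => s _; rewrite inE orbC.
have [//|/rotate_centred[p ltpn sp]] := boolP (s \in deficient).
by apply/orP; right; apply/bigcupP; exists (Ordinal ltpn) => //; rewrite [s \in _]in_set.
Qed.

(** Each of the [n] arcs is a uniformly random [r]-set, so it lies in [G] with probability
    [#|G| / 'C(n, r)]. *)
Lemma narcs_sum : (\sum_s narcs s) * 'C(n, r) = n * #|G| * #|{perm T}|.
Proof.
transitivity (\sum_(i < n) #|G| * #|{perm T}|); last first.
  by rewrite sum_nat_const card_ord mulnA.
rewrite exchange_big big_distrl /=.
apply: eq_bigr => i _; rewrite -(card_perm_imset_in (A := arc i)); last first.
  by move=> e /G_card; rewrite card_arc.
rewrite cardT card_arc -sum1_card [in RHS]big_mkcond /=; congr (_ * _).
by apply: eq_bigr => s _; rewrite inE /arc_in; case: (_ \in G).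
Qed.

Lemma narcs_sum_le : \sum_s narcs s + #|deficient| <= r * #|{perm T}|.
Proof.
rewrite -sum1_card [X in _ + X]big_mkcond -big_split mulnC -sum_nat_const /=.
apply: leq_sum => s _; have := narcs_le s; rewrite inE.
by case: (eqVneq (narcs s) r) => /=; lia.
Qed.

Lemma escape_swap v k : 0 < k -> k.+1 < n ->
  escape (centred :&: based v) (tperm (c k) (c k.+1)) <= #|deficient :&: based v|.
Proof.
move=> k_gt0 kn; rewrite /escape; set t := tperm _ _.
rewrite -[leqLHS](card_imset _ (mulgI t)); apply/subset_leq_card/subsetP.
move=> _ /imsetP[s + ->]; rewrite [s \in _]in_set => /andP[/setIP[sc sv]].
have t0 : t (c 0) = c 0.
  by rewrite tpermD //; apply/eqP => /circ_inj; rewrite !inE; lia.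
have tsv : (t * s)%g \in based v by move: sv; rewrite !inE permM t0.
rewrite !in_setI tsv !andbT; apply: contraNT.
exact: swap_centred.
Qed.

Lemma escape_fix v (p : {perm T}) : p (c 0) = c 0 ->
  escape (centred :&: based v) p <= 2 * n ^ 2 * #|deficient :&: based v|.
Proof.
move=> p0; set b := #|_|; set f := escape _.
(* Starting the range at 1 keeps all swaps away from position 0. At most [n] transpositions, each
   spanning fewer than [n] places, give the factor [2 * n ^ 2]. *)
have f_t i d : 0 < i -> i + d < n -> f (tperm (c i) (c (i + d))) <= 2 * d * b.
  apply: (@subadditive_tperm T f (escape1 _) (escapeM _) c 1 n b).
    by move=> j k /andP[_ jn] /andP[_ kn]; apply: circ_inj.
  by move=> k k0 kn; apply: escape_swap.
have f_tn x y : x \in [set~ c 0] -> y \in [set~ c 0] -> f (tperm x y) <= 2 * n * b.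
  have [i ltin ->] := circP x; have [j ltjn ->] := circP y; rewrite !inE => i0 j0.
  wlog le_ij : i j ltin ltjn i0 j0 / i <= j => [IH|].
    by have [/IH->//|/ltnW/IH] := leqP i j; rewrite tpermC; apply.
  have i_gt0 : 0 < i by rewrite lt0n; apply: contraNneq i0 => ->.
  rewrite -(subnKC le_ij); apply: leq_trans (f_t i (j - i) i_gt0 _) _.
    by rewrite subnKC.
  by rewrite leq_mul2r leq_mul2l; apply/orP; right; lia.
have pD : perm_on [set~ c 0] p.
  by apply/subsetP => x; rewrite !inE; apply: contraNneq => ->; rewrite p0.
apply: leq_trans (subadditive_perm (escape1 _) (escapeM _) f_tn pD) _.
rewrite cardsC1 cardT; apply: leq_trans (leq_mul (leq_pred n) (leqnn _)) _.
by rewrite -mulnn; lia.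
Qed.

(** The sum of the escape counts over the stabiliser [H] of position 0 is computed exactly by
    [sum_escape] and bounded termwise by [escape_fix]; [based v] is a coset of [H]. *)
Lemma centred_dichotomy v :
  #|centred :&: based v| * (#|based v| - #|centred :&: based v|)
    <= #|based v| * (2 * n ^ 2 * #|deficient :&: based v|).
Proof.
set W := centred :&: based v.
have [->|[s0 s0W]] := set_0Vmem W; first by rewrite cards0.
have s0v : s0 \in based v by case/setIP: s0W.
pose H : {set {perm T}} := [set p : {perm T} | p (c 0) == c 0].
have HC s t : s \in W -> ((t * s^-1)%g \in H) = (t \in based v).
  case/setIP=> _; rewrite !inE permM => /eqP <-.
  by rewrite -{2}(permK s (c 0)) (inj_eq perm_inj).
rewrite -(sum_escape (subsetIr _ _) HC).
have -> : #|based v| = #|H|.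
  rewrite -(card_imset _ (mulIg s0^-1%g)); apply: eq_card => p.
  apply/imsetP/idP => [[t tv ->]|pH]; first by rewrite HC.
  by exists (p * s0)%g; rewrite ?mulgK // -(HC s0) // mulgK.
rewrite -sum_nat_const; apply: leq_sum => p; rewrite inE => /eqP.
exact: escape_fix.
Qed.

(** In a centred placement with [v] at position 0, arc 0 is an edge through [v]; over all of
    [based v] it is uniform among the [r]-sets through [v]. *)
Lemma card_star_ge v :
  #|centred :&: based v| * 'C(n.-1, r.-1) <= #|[set e in G | v \in e]| * #|based v|.
Proof.
have c0A : c 0 \in arc 0 by rewrite mem_arc // add0n r_gt0.
rewrite -(card_perm_imset_in_at c0A) => [|e]; last first.
  by rewrite inE => /andP[/G_card-> ->]; rewrite card_arc.
rewrite cardT card_arc leq_mul2r subset_leq_card ?orbT //.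
apply/subsetP => s /setIP[/centredP sc]; rewrite !inE => /eqP sv.
by rewrite sv eqxx -/(arc_in s 0) sc //= -sv imset_f.
Qed.

Lemma card_family_deficient v :
  r * #|G| * #|based v| + #|deficient :&: based v| * 'C(n.-1, r.-1)
    <= r * #|based v| * 'C(n.-1, r.-1).
Proof.
have bin_r : r * 'C(n, r) = n * 'C(n.-1, r.-1).
  by rewrite mul_bin_diag prednK.
have C_gt0 : 0 < 'C(n, r) by rewrite bin_gt0; lia.
have := narcs_sum_le; rewrite -(leq_pmul2r C_gt0) mulnDl narcs_sum.
rewrite -(card_deficient_based v) -(card_based_perm v).
move: #|G| #|based v| #|_ :&: _| bin_r => g M b bin_r le1.
rewrite -(leq_pmul2l n_gt0) -(leq_pmul2l n_gt0).
have := leq_mul (leqnn r) le1; nia.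
Qed.

Lemma katona_stability :
  #|G| <= 'C(n.-1, r.-1) /\
  ((exists v, #|[set e in G | v \notin e]| <= 4 * n ^ 2 * r * ('C(n.-1, r.-1) - #|G|))
   \/ 'C(n.-1, r.-1) <= (4 * n ^ 3 + 1) * r * ('C(n.-1, r.-1) - #|G|)).
Proof.
set N := 'C(_, _); pose M := #|based x0|; pose b := #|deficient :&: based x0|.
have M_gt0 : 0 < M.
  rewrite -(ltn_pmul2l n_gt0) card_based_perm muln0.
  by apply/card_gt0P; exists 1%g.
have eqM v : #|based v| = M.
  by apply/eqP; rewrite -(eqn_pmul2l n_gt0) !card_based_perm.
have eqb v : #|deficient :&: based v| = b.
  by apply/eqP; rewrite -(eqn_pmul2l n_gt0) !card_deficient_based.
have := card_family_deficient x0; rewrite -/N -/M -/b => le_gb.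
have g_le : #|G| <= N by rewrite -(leq_pmul2l r_gt0) -(leq_pmul2r M_gt0); nia.
have b_le : b * N <= r * M * (N - #|G|) by rewrite mulnBr; nia.
(* With threshold one half, one factor of the dichotomy is at least [M / 2], and the other is then
   at most [4 * n ^ 2 * b]. *)
split=> //; have [/existsP[v vP]|] := boolP [exists v, M < 2 * #|centred :&: based v|].
  left; exists v; rewrite -(leq_pmul2r M_gt0).
  have := centred_dichotomy v; have := card_star_ge v.
  rewrite eqM eqb -/N.
  have w_le : #|centred :&: based v| <= M by rewrite -(eqM v) subset_leq_card ?subsetIr.
  have -> : #|[set e in G | v \notin e]| = #|G| - #|[set e in G | v \in e]|.
    rewrite -(cardsID [set e : {set T} | v \in e] G).
    rewrite (_ : #|[set e in G | v \in e]| = #|G :&: [set e : {set T} | v \in e]|).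
      by rewrite addKn; apply: eq_card => e; rewrite !inE andbC.
    by apply: eq_card => e; rewrite !inE.
  move: #|_ :&: _| #|[set _ in _ | _]| w_le vP => w gv w_le vP star dich.
  have dw : M - w <= 4 * n ^ 2 * b.
    rewrite -(leq_pmul2r M_gt0).
    have : (M - w) * M <= (M - w) * (2 * w) by rewrite leq_mul2l ltnW ?orbT.
    lia.
  have dN : N * (M - w) <= N * (4 * n ^ 2 * b) by rewrite leq_mul2l dw orbT.
  have gN : #|G| * M <= N * M by rewrite leq_mul2r g_le orbT.
  have bN : 4 * n ^ 2 * (b * N) <= 4 * n ^ 2 * (r * M * (N - #|G|)).
    by rewrite leq_mul2l b_le orbT.
  rewrite mulnBr in dN; rewrite mulnBl; lia.
rewrite negb_exists => /forallP small; right.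
have w_le v : #|centred :&: based v| <= 4 * n ^ 2 * b.
  have := centred_dichotomy v; have := small v; rewrite eqM eqb -leqNgt.
  move: #|_ :&: _| => w wM dich; rewrite -(leq_pmul2r M_gt0).
  have : w * M <= w * (2 * (M - w)) by rewrite leq_mul2l; apply/orP; right; lia.
  lia.
(* Sum the bound [4 * n ^ 2 * b] over the [n] vertices; the extra 1 accounts for the deficient
   placements. *)
have M_le : M <= (4 * n ^ 3 + 1) * b.
  rewrite -(leq_pmul2l n_gt0) card_based_perm.
  have := card_perm_le; rewrite -sum_centred_based -(card_deficient_based x0) -/b.
  have : \sum_v #|centred :&: based v| <= n * (4 * n ^ 2 * b).
    by rewrite -cardT -sum_nat_const; apply: leq_sum => v _; rewrite cardT.
  move: (\sum_v _) => s s_le; have : n * s <= n * (n * (4 * n ^ 2 * b)).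
    by rewrite leq_mul2l s_le orbT.
  rewrite expnS; lia.
rewrite -(leq_pmul2r M_gt0).
have := leq_mul M_le (leqnn N); have := leq_mul (leqnn (4 * n ^ 3 + 1)) b_le.
lia.
Qed.
End Family.
End Circle.

(** * Real estimates and conclusion *)

Local Open Scope ring_scope.

Theorem theorem3 (R : realType) (n r : nat) (delta : R) (G : r_graph r)
    (r_ge1 : (1 <= r)%N) (r_lt_half : (2 * r < n)%N)
    (delta_lt : delta < 10 ^- 3 * n%:R ^- 4)
    (card_vertex : #|vertex G| = n)
    (G_int : intersecting G)
    (G_large : (1 - delta) * 'C(n - 1, r - 1)%:R < #|edges G|%:R) :
  exists v : vertex G,
    #|[set e in edges G | v \notin e]|%:R
      <= 25 * n%:R * Num.sqrt delta * 'C(n - 1, r - 1)%:R.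
Proof.
have n_gt0 : (0 < n)%N by lia.
have [x0 _] : exists x0 : vertex G, x0 \in vertex G.
  by apply/card_gt0P; rewrite card_vertex.
have [] := katona_stability x0 card_vertex r_ge1 r_lt_half (@edges_card r G) G_int.
rewrite !subn1 in G_large *; set N := 'C(_, _) in G_large *.
have N_gt0 : (0 < N)%N by rewrite bin_gt0; lia.
move=> g_le stab.
have d_lt : (N - #|edges G|)%:R < delta * N%:R :> R by rewrite natrB //; lra.
have nR : 1 <= n%:R :> R by rewrite ler1n.
have nR0 : 0 < n%:R :> R by rewrite ltr0n.
have NR : 0 < N%:R :> R by rewrite ltr0n.
have rR : 2 * r%:R <= n%:R :> R by rewrite -natrM ler_nat ltnW.
have r0R : 0 < r%:R :> R by rewrite ltr0n.
have d0 : 0 <= (N - #|edges G|)%:R :> R by [].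
have delta_gt0 : 0 < delta by rewrite -(pmulr_lgt0 _ NR); lra.
have {}delta_lt : 1000 * (delta * n%:R ^+ 4) < 1.
  move: delta_lt; rewrite -invfM -[_^-1]div1r ltr_pdivlMr ?mulr_gt0 ?exprn_gt0 //.
  by rewrite mulrCA -natrX.
have rn (m : R) : 0 <= m ->
  2 * (m * r%:R * (N - #|edges G|)%:R) <= m * n%:R * (delta * N%:R).
  move=> m0; rewrite !mulrA -mulrA [2 * m]mulrC -!mulrA ler_wpM2l // mulrA.
  by apply: ler_pM => //; [lra|apply: ltW].
set x := Num.sqrt delta.
have x_ge0 : 0 <= x by apply: sqrtr_ge0.
have x2 : x ^+ 2 = delta by rewrite sqr_sqrtr // ltW.
case: stab => [[v v_le]|].
  exists v; have {}v_le : #|[set e in edges G | v \notin e]|%:R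
      <= 4 * n%:R ^+ 2 * r%:R * (N - #|edges G|)%:R :> R.
    by rewrite -natrX -!natrM ler_nat.
  have h : 2 * (4 * n%:R ^+ 2 * r%:R * (N - #|edges G|)%:R)
      <= 4 * n%:R ^+ 2 * n%:R * (delta * N%:R) :> R.
    by apply: rn; rewrite mulr_ge0 ?exprn_ge0.
  (* This trades the bound of order [n ^ 3 * delta] for one of order [n] times the square root of
     [delta]. *)
  have xn : x * n%:R ^+ 2 <= 1.
    rewrite -(@ler_pXn2r _ 2) ?nnegrE ?mulr_ge0 ?exprn_ge0 // exprMn x2 -exprM expr1n.
    by move: delta_lt; set t := delta * _; lra.
  rewrite -x2 in h.
  have xnN : 0 <= n%:R * x * N%:R by rewrite !mulr_ge0.
  have : n%:R * x * N%:R * (x * n%:R ^+ 2) <= n%:R * x * N%:R * 1 by rewrite ler_wpM2l.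
  lra.
rewrite -(ler_nat R) !natrM natrD natrM natrX => N_le.
have := rn (4 * n%:R ^+ 3 + 1); rewrite addr_ge0 ?mulr_ge0 ?exprn_ge0 // => /(_ isT) h.
(* The second alternative is contradictory: it gives [N] at most [5 / 2 * n ^ 4 * delta * N], which
   is below [N / 400]. *)
have n1 : n%:R <= n%:R ^+ 4 :> R by rewrite ler_eXnr.
have := ler_wpM2r (ltW (mulr_gt0 delta_gt0 NR)) n1.
have : 1000 * (delta * n%:R ^+ 4) * N%:R < 1 * N%:R by rewrite ltr_pM2r.
lra.
Qed.
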